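(* Let $v\mathcal F=\{F\in\mathcal F\mid hF=0,\ \omega(F)=0\}$ and $\mathcal F_2=\{F\in\mathcal F\mid F=F_7(F)\}$, $\mathcal F_3=\{F\in\mathcal F\mid F=F_8(F)\}$, $\mathcal F_4=\{F\in\mathcal F\mid F=F_4(F)=F_5(F),\ f(F)(\xi)=0\}$, $\mathcal F_5=\{F\in\mathcal F\mid F=F_4(F)=-F_5(F),\ f^*(F)(\xi)=0\}$, $\mathcal F_6=\{F\in\mathcal F\mid F=-F_4(F)=F_5(F)\}$, $\mathcal F_7=\{F\in\mathcal F\mid F=-F_4(F)=-F_5(F)\}$, $\mathcal F_8=\{F\in\mathcal F\mid hF=0,\ F(x,y,\xi)=0 \text{ for all } x,y\in V\}$. Then $$v\mathcal F=\mathcal F_2\oplus\mathcal F_3\oplus\mathcal F_4\oplus\mathcal F_5\oplus\mathcal F_6\oplus\mathcal F_7\oplus\mathcal F_8 .$$ This decomposition is orthogonal and invariant under the action of $U(n)\times 1$. The components $p_i(F)$ of $F\in\mathcal F$ in $\mathcal F_i$ ($i=2,\dots,8$) are $$\begin{aligned} p_2(F)&=F_7(F),\\ p_3(F)&=F_8(F),\\ p_4(F)&=\tfrac14\{F_2(F)+F_4(F)+F_5(F)+F_6(F)-4F_7(F)-F_3(F)\},\\ p_5(F)&=\tfrac14\{F_2(F)+F_4(F)-F_5(F)-F_6(F)-4F_8(F)-F_3(F)\},\\ p_6(F)&=\tfrac14\{F_2(F)-F_4(F)+F_5(F)-F_6(F)-F_3(F)\},\\ p_7(F)&=\tfrac14\{F_2(F)-F_4(F)-F_5(F)+F_6(F)-F_3(F)\},\\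 p_8(F)&=F_1(F)-F_3(F). \end{aligned}$$
   Context: Let $n\ge 1$ and let $V$ be a $(2n+1)$-dimensional real vector space with an almost contact metric structure $(\varphi,\xi,\eta,g)$: $\varphi$ is an endomorphism of $V$, $\xi\in V$, $\eta\in V^*$, $g$ is a positive definite inner product, and for all $x,y\in V$: $\varphi^2x=-x+\eta(x)\xi$, $\varphi(\xi)=0$, $\eta\circ\varphi=0$, $g(\xi,\xi)=1$, $g(\varphi x,\varphi y)=g(x,y)-\eta(x)\eta(y)$. Put $hx=-\varphi^2x$. $\mathcal F$ is the subspace of $V^*\otimes V^*\otimes V^*$ of all trilinear forms $F$ with $F(x,y,z)=-F(x,z,y)=-F(x,\varphi y,\varphi z)+\eta(y)F(x,\xi,z)+\eta(z)F(x,y,\xi)$ for all $x,y,z\in V$. It carries the inner product $\langle F',F''\rangle=\sum_{i,j,k}F'(e_i,e_j,e_k)F''(e_i,e_j,e_k)$, where $\{e_i\}$ is an orthonormal basis of $V$. $U(n)\times 1$ denotes the group of linear automorphisms of $V$ preserving $(\varphi,\xi,\eta,g)$; it acts on $\mathcal F$ by $(aF)(x,y,z)=F(a^{-1}x,a^{-1}y,a^{-1}z)$. For $F\in\mathcal F$ define the covectors $f(F)(z)=\sum_iF(e_i,e_i,z)$, $f^*(F)(z)=\sum_iF(e_i,\varphi e_i,z)$, $\omega(F)(z)=F(\xi,\xi,z)$, and the following elements of $\mathcal F$ (the operators $F_i(\cdot)$ are distinct from the subspaces $\mathcal F_i$): $hF(x,y,z)=F(hx,hy,hz)$; $F_1(F)(x,y,z)=\eta(x)F(\xi,y,z)$;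 $F_2(F)(x,y,z)=\eta(y)F(x,\xi,z)-\eta(z)F(x,\xi,y)$; $F_3(F)(x,y,z)=\eta(x)\eta(y)F(\xi,\xi,z)-\eta(x)\eta(z)F(\xi,\xi,y)$; $F_4(F)(x,y,z)=\eta(y)F(\varphi x,\xi,\varphi z)-\eta(z)F(\varphi x,\xi,\varphi y)$; $F_5(F)(x,y,z)=\eta(y)F(z,\xi,x)-\eta(z)F(y,\xi,x)$; $F_6(F)(x,y,z)=\eta(y)F(\varphi z,\xi,\varphi x)-\eta(z)F(\varphi y,\xi,\varphi x)$; $F_7(F)(x,y,z)=\frac1{2n}f(F)(\xi)\{\eta(z)g(x,y)-\eta(y)g(x,z)\}$; $F_8(F)(x,y,z)=-\frac1{2n}f^*(F)(\xi)\{\eta(z)g(x,\varphi y)-\eta(y)g(x,\varphi z)\}$. The component of $F\in\mathcal F$ in $\mathcal F_i$ means the orthogonal projection of $F$ onto $\mathcal F_i\subset\mathcal F$. *)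

(* Defs.v *)
From HB Require Import structures.
From mathcomp Require Import all_boot all_order all_algebra.
From mathcomp Require Import boolp classical_sets reals.
From mathcomp Require Import ring.

Set Implicit Arguments.
Unset Strict Implicit.
Unset Printing Implicit Defensive.

Import Order.TTheory GRing.Theory Num.Theory.
Local Open Scope ring_scope.

Section Subspaces.
Variables (R : realType) (W : vectType R).

Definition linear_subset (P : set W) : Prop :=
  P 0 /\ forall (a : R) (u v : W), P u -> P v -> P (a *: u + v).

Lemma linear_subset_vspace (P : set W) :
  linear_subset P -> exists U : {vspace W}, forall v, v \in U <-> P v.
Proof.
move=> [P0 PL].
pose Q k := `[< exists U : {vspace W}, (forall v, v \in U -> P v) /\ \dim U = k >].
have exQ : exists k, Q k.
  exists 0%N; apply/asboolP; exists 0%VS; split; last exact: dimv0.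
  by move=> v; rewrite memv0 => /eqP->.
have ubQ k : Q k -> (k <= \dim {: W})%N.
  by move=> /asboolP[U [_ <-]]; apply/dimvS/subvf.
have [k /asboolP[U [UP dU]] kmax] := ex_maxnP exQ ubQ.
exists U => v; split; first exact: UP.
move=> Pv; case: (boolP (v \in U)) => // vU; exfalso.
have := kmax (\dim (U + <[v]>)%VS); rewrite -dU => H.
have sUU : (U <= U + <[v]>)%VS by exact: addvSl.
have : (\dim (U + <[v]>) <= \dim U)%N.
  apply: H; apply/asboolP; exists (U + <[v]>)%VS; split => // w.
  case/memv_addP => u uU [_ /vlineP[c ->] ->].
  by rewrite addrC; apply: PL => //; apply: UP.
move=> le; have /eqP E : (U == U + <[v]>)%VS by rewrite eqEdim sUU le.
by move/negP: vU; apply; rewrite E; apply: (subvP (addvSr U <[v]>)); apply: memv_line.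
Qed.

(* A set closed under linear combinations, as a [{vspace W}]. *)
Definition subspace (P : set W) (hP : linear_subset P) : {vspace W} :=
  projT1 (cid (linear_subset_vspace hP)).

Lemma mem_subspace (P : set W) (hP : linear_subset P) (v : W) :
  v \in subspace hP <-> P v.
Proof. exact: (projT2 (cid (linear_subset_vspace hP))). Qed.

End Subspaces.

Definition trilinear (R : realType) (V : vectType R) (t : V -> V -> V -> R) : Prop :=
  [/\ forall y z (a : R) u v, t (a *: u + v) y z = a * t u y z + t v y z,
      forall x z (a : R) u v, t x (a *: u + v) z = a * t x u z + t x v z &
      forall x y (a : R) u v, t x y (a *: u + v) = a * t x y u + t x y v].

Record trilinear_form (R : realType) (V : vectType R) := Trilinear {
  tri_fun :> V -> V -> V -> R;
  tri_trilinear : trilinear tri_fun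
}.

Section TrilinearForms.
Variables (R : realType) (V : vectType R).
Local Notation T := (trilinear_form V).
Implicit Types F G : T.

Lemma triP F G : (forall x y z, F x y z = G x y z) -> F = G.
Proof.
case: F G => [f hf] [g hg] /= fg.
have E : f = g by apply/funext => x; apply/funext => y; apply/funext => z.
by case: _ / E hg => hg; congr Trilinear; exact: Prop_irrelevance.
Qed.

Lemma triDl F (a : R) u v y z : F (a *: u + v) y z = a * F u y z + F v y z.
Proof. by have [h _ _] := tri_trilinear F. Qed.
Lemma triDm F (a : R) x u v z : F x (a *: u + v) z = a * F x u z + F x v z.
Proof. by have [_ h _] := tri_trilinear F. Qed.
Lemma triDr F (a : R) x y u v : F x y (a *: u + v) = a * F x y u + F x y v.
Proof. by have [_ _ h] := tri_trilinear F. Qed.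

Lemma tri_zero_subproof : trilinear (fun _ _ _ : V => 0 : R).
Proof. by split=> *; rewrite mulr0 addr0. Qed.
Lemma tri_opp_subproof F : trilinear (fun x y z => - F x y z).
Proof. by split=> *; rewrite ?(triDl, triDm, triDr); ring. Qed.
Lemma tri_add_subproof F G : trilinear (fun x y z => F x y z + G x y z).
Proof. by split=> *; rewrite ?(triDl, triDm, triDr); ring. Qed.
Lemma tri_scale_subproof (a : R) F : trilinear (fun x y z => a * F x y z).
Proof. by split=> *; rewrite ?(triDl, triDm, triDr); ring. Qed.

Definition tri_zero : T := Trilinear tri_zero_subproof.
Definition tri_opp F : T := Trilinear (tri_opp_subproof F).
Definition tri_add F G : T := Trilinear (tri_add_subproof F G).
Definition tri_scale (a : R) F : T := Trilinear (tri_scale_subproof a F).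

Lemma tri_addA : associative tri_add.
Proof. by move=> F G H; apply: triP => x y z /=; rewrite addrA. Qed.
Lemma tri_addC : commutative tri_add.
Proof. by move=> F G; apply: triP => x y z /=; rewrite addrC. Qed.
Lemma tri_add0 : left_id tri_zero tri_add.
Proof. by move=> F; apply: triP => x y z /=; rewrite add0r. Qed.
Lemma tri_addN : left_inverse tri_zero tri_opp tri_add.
Proof. by move=> F; apply: triP => x y z /=; rewrite addNr. Qed.

HB.instance Definition _ := gen_eqMixin T.
HB.instance Definition _ := gen_choiceMixin T.
HB.instance Definition _ :=
  GRing.isZmodule.Build T tri_addA tri_addC tri_add0 tri_addN.

Lemma tri_scaleA (a b : R) F : tri_scale a (tri_scale b F) = tri_scale (a * b) F.
Proof. by apply: triP => x y z /=; rewrite mulrA. Qed.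
Lemma tri_scale1 : left_id 1 tri_scale.
Proof. by move=> F; apply: triP => x y z /=; rewrite mul1r. Qed.
Lemma tri_scaleDr : right_distributive tri_scale +%R.
Proof. by move=> a F G; apply: triP => x y z /=; rewrite mulrDr. Qed.
Lemma tri_scaleDl F : {morph tri_scale^~ F : a b / a + b}.
Proof. by move=> a b; apply: triP => x y z /=; rewrite mulrDl. Qed.

HB.instance Definition _ := GRing.Zmodule_isLmodule.Build R T
  tri_scaleA tri_scale1 tri_scaleDr tri_scaleDl.

Lemma tri0E x y z : (0 : T) x y z = 0. Proof. by []. Qed.
Lemma triNE F x y z : (- F) x y z = - F x y z. Proof. by []. Qed.
Lemma triDE F G x y z : (F + G) x y z = F x y z + G x y z. Proof. by []. Qed.
Lemma triZE (a : R) F x y z : (a *: F) x y z = a * F x y z. Proof. by []. Qed.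

Let d := \dim {: V}.
Let b : d.-tuple V := vbasis {: V}.
Let I := ('I_d * 'I_d * 'I_d)%type.
Let c (i : 'I_d) (x : V) : R := coord b i x.

Let cD i (a : R) u v : c i (a *: u + v) = a * c i u + c i v.
Proof. by rewrite /c linearP. Qed.

Lemma tri_row_subproof (r : 'rV[R]_#|{: I}|) :
  trilinear (fun x y z => \sum_(s : I)
    r 0 (enum_rank s) * (c s.1.1 x * c s.1.2 y * c s.2 z)).
Proof.
split=> *; rewrite mulr_sumr -big_split /=; apply: eq_bigr => s _;
  rewrite cD; ring.
Qed.

Let of_row r : T := Trilinear (tri_row_subproof r).
Let to_row F : 'rV[R]_#|{: I}| :=
  \row_k (let s : I := @enum_val I (mem {: I}) k in F b`_s.1.1 b`_s.1.2 b`_s.2).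

Lemma tri_suml F (f : 'I_d -> R) (w : 'I_d -> V) y z :
  F (\sum_i f i *: w i) y z = \sum_i f i * F (w i) y z.
Proof.
have F0 : F 0 y z = 0.
  by have := triDl F (-1) 0 0 y z; rewrite scaler0 addr0 mulN1r addNr.
by elim/big_rec2: _ => // i p q _ <-; rewrite triDl.
Qed.
Lemma tri_summ F (f : 'I_d -> R) (w : 'I_d -> V) x z :
  F x (\sum_i f i *: w i) z = \sum_i f i * F x (w i) z.
Proof.
have F0 : F x 0 z = 0.
  by have := triDm F (-1) x 0 0 z; rewrite scaler0 addr0 mulN1r addNr.
by elim/big_rec2: _ => // i p q _ <-; rewrite triDm.
Qed.
Lemma tri_sumr F (f : 'I_d -> R) (w : 'I_d -> V) x y :
  F x y (\sum_i f i *: w i) = \sum_i f i * F x y (w i).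
Proof.
have F0 : F x y 0 = 0.
  by have := triDr F (-1) x y 0 0; rewrite scaler0 addr0 mulN1r addNr.
by elim/big_rec2: _ => // i p q _ <-; rewrite triDr.
Qed.

Lemma tri_vect_iso : Vector.axiom #|{: I}| T.
Proof.
exists to_row; first by move=> a F G; apply/rowP => k; rewrite !mxE.
have cb (i j : 'I_d) : c i b`_j = (i == j)%:R.
  by rewrite /c coord_free ?(basis_free (vbasisP _)) // eq_sym.
exists of_row => [F|r].
  apply: triP => x y z /=.
  rewrite [x in RHS](coord_vbasis (memvf x)) [y in RHS](coord_vbasis (memvf y)).
  rewrite [z in RHS](coord_vbasis (memvf z)) tri_suml.
  under [RHS]eq_bigr => i _ do
    (rewrite tri_summ; under eq_bigr => j _ do rewrite tri_sumr).
  under [RHS]eq_bigr => i _ do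
    (rewrite mulr_sumr; under eq_bigr => j _ do rewrite 2!mulr_sumr).
  rewrite pair_bigA pair_bigA /=; apply: eq_bigr => -[[i j] k] _ /=.
  by rewrite mxE enum_rankK /= /c; ring.
apply/rowP => k; rewrite mxE /=.
case E: (enum_val k) => [[i j] l] /=.
rewrite (bigD1 (i, j, l)) //= !cb !eqxx !mulr1 -E enum_valK big1 ?addr0 //.
move=> [[i' j'] l'] ne /=; rewrite !cb.
case: (i' =P i) ne => [->|_] ne; last by rewrite !mul0r mulr0.
case: (j' =P j) ne => [->|_] ne; last by rewrite mulr0 mul0r mulr0.
case: (l' =P l) ne => [->|_] ne; last by rewrite !mulr0.
by move: ne => /eqP; case.
Qed.

HB.instance Definition _ := Lmodule_hasFinDim.Build R T tri_vect_iso.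

End TrilinearForms.

(* [{dot V for idfun}]: symmetric positive definite bilinear forms. *)
Record almost_contact_metric (R : realType) (V : vectType R) := AlmostContactMetric {
  phi : 'End(V);
  xi : V;
  eta : {scalar V};
  met : {dot V for (@idfun R)};
  phi_phi : forall x, phi (phi x) = - x + eta x *: xi;
  phi_xi : phi xi = 0;
  eta_phi : forall x, eta (phi x) = 0;
  met_xi : met xi xi = 1;
  met_phi : forall x y, met (phi x) (phi y) = met x y - eta x * eta y
}.

Section Operators.
Variables (R : realType) (V : vectType R) (A : almost_contact_metric V).
Variables (n : nat) (e : (2 * n).+1.-tuple V).

Local Notation φ := (phi A).
Local Notation ξ := (xi A).
Local Notation η := (eta A).
Local Notation g := (met A).
Local Notation T := (trilinear_form V).
Implicit Types F G : T.

Definition orthonormal_basis : Prop :=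
  basis_of fullv e /\ forall i j, g (tnth e i) (tnth e j) = (i == j)%:R.

Definition hproj (x : V) : V := - φ (φ x).

(* [e] is meant to be orthonormal; [inner], [ftrace] and [fstar] then do not
   depend on its choice. *)
Definition inner F G : R :=
  \sum_(x <- e) \sum_(y <- e) \sum_(z <- e) F x y z * G x y z.

Definition ftrace F (z : V) : R := \sum_(x <- e) F x x z.
Definition fstar F (z : V) : R := \sum_(x <- e) F x (φ x) z.
Definition omega F (z : V) : R := F ξ ξ z.

Lemma metDl (a : R) u v x : g (a *: u + v) x = a * g u x + g v x.
Proof. by rewrite linearPl. Qed.
Lemma metDr (a : R) u v x : g x (a *: u + v) = a * g x u + g x v.
Proof. by rewrite linearPr. Qed.
Lemma etaD (a : R) u v : η (a *: u + v) = a * η u + η v.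
Proof. by rewrite linearP. Qed.
Lemma phiD (a : R) u v : φ (a *: u + v) = a *: φ u + φ v.
Proof. by rewrite linearP. Qed.
Lemma hprojD (a : R) u v : hproj (a *: u + v) = a *: hproj u + hproj v.
Proof. by rewrite /hproj !phiD opprD scalerN. Qed.

Ltac tri :=
  split=> *; rewrite ?(hprojD, phiD) ?(triDl, triDm, triDr, metDl, metDr, etaD);
  ring.

Lemma hF_trilinear F : trilinear (fun x y z =>
  F (hproj x) (hproj y) (hproj z)).
Proof. by tri. Qed.
Definition hF F : T := Trilinear (hF_trilinear F).

Lemma F1_trilinear F : trilinear (fun x y z =>
  η x * F ξ y z).
Proof. by tri. Qed.
Definition F1 F : T := Trilinear (F1_trilinear F).

Lemma F2_trilinear F : trilinear (fun x y z =>
  η y * F x ξ z - η z * F x ξ y).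
Proof. by tri. Qed.
Definition F2 F : T := Trilinear (F2_trilinear F).

Lemma F3_trilinear F : trilinear (fun x y z =>
  η x * η y * F ξ ξ z - η x * η z * F ξ ξ y).
Proof. by tri. Qed.
Definition F3 F : T := Trilinear (F3_trilinear F).

Lemma F4_trilinear F : trilinear (fun x y z =>
  η y * F (φ x) ξ (φ z) - η z * F (φ x) ξ (φ y)).
Proof. by tri. Qed.
Definition F4 F : T := Trilinear (F4_trilinear F).

Lemma F5_trilinear F : trilinear (fun x y z =>
  η y * F z ξ x - η z * F y ξ x).
Proof. by tri. Qed.
Definition F5 F : T := Trilinear (F5_trilinear F).

Lemma F6_trilinear F : trilinear (fun x y z =>
  η y * F (φ z) ξ (φ x) - η z * F (φ y) ξ (φ x)).
Proof. by tri. Qed.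
Definition F6 F : T := Trilinear (F6_trilinear F).

Lemma F7_trilinear F : trilinear (fun x y z =>
  (2 * n)%:R^-1 * ftrace F ξ * (η z * g x y - η y * g x z)).
Proof. by tri. Qed.
Definition F7 F : T := Trilinear (F7_trilinear F).

Lemma F8_trilinear F : trilinear (fun x y z =>
  - (2 * n)%:R^-1 * fstar F ξ * (η z * g x (φ y) - η y * g x (φ z))).
Proof. by tri. Qed.
Definition F8 F : T := Trilinear (F8_trilinear F).

Lemma ftraceD (a : R) F G z : ftrace (a *: F + G) z = a * ftrace F z + ftrace G z.
Proof. by rewrite /ftrace mulr_sumr -big_split. Qed.
Lemma fstarD (a : R) F G z : fstar (a *: F + G) z = a * fstar F z + fstar G z.
Proof. by rewrite /fstar mulr_sumr -big_split. Qed.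

Lemma hFD (a : R) F G : hF (a *: F + G) = a *: hF F + hF G.
Proof. by apply: triP => x y z; rewrite /= ?triDE ?triZE /=; ring. Qed.
Lemma F4D (a : R) F G : F4 (a *: F + G) = a *: F4 F + F4 G.
Proof. by apply: triP => x y z; rewrite /= ?triDE ?triZE /=; ring. Qed.
Lemma F5D (a : R) F G : F5 (a *: F + G) = a *: F5 F + F5 G.
Proof. by apply: triP => x y z; rewrite /= ?triDE ?triZE /=; ring. Qed.
Lemma F7D (a : R) F G : F7 (a *: F + G) = a *: F7 F + F7 G.
Proof. by apply: triP => x y z; rewrite /= ?triDE ?triZE /=; rewrite ftraceD; ring. Qed.
Lemma F8D (a : R) F G : F8 (a *: F + G) = a *: F8 F + F8 G.
Proof. by apply: triP => x y z; rewrite /= ?triDE ?triZE /=; rewrite fstarD; ring. Qed.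

Lemma linear_op0 (o : T -> T) :
  (forall (a : R) F G, o (a *: F + G) = a *: o F + o G) -> o 0 = 0.
Proof. by move=> oD; have := oD (-1) 0 0; rewrite scaler0 addr0 scaleN1r addNr. Qed.

Definition is_calF F : Prop :=
  (forall x y z, F x y z = - F x z y) /\
  (forall x y z,
    F x y z = - F x (φ y) (φ z) + η y * F x ξ z + η z * F x y ξ).

Lemma calF_linear : linear_subset is_calF.
Proof.
split=> [|a F G [FA FB] [GA GB]].
  by split=> x y z; rewrite !tri0E ?mulr0 oppr0 ?addr0.
split=> x y z; rewrite !triDE !triZE; first by rewrite FA GA; ring.
by rewrite FB GB; ring.
Qed.
Definition calF : {vspace T} := subspace calF_linear.

Ltac lin := rewrite ?mem0v ?(linear_op0 hFD) ?(linear_op0 F4D)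
  ?(linear_op0 F5D) ?(linear_op0 F7D) ?(linear_op0 F8D) ?oppr0 //.

Definition is_vcalF F : Prop := [/\ F \in calF, hF F = 0 & forall z, omega F z = 0].
Lemma vcalF_linear : linear_subset is_vcalF.
Proof.
split=> [|a F G [FF F0 Fo] [GG G0 Go]]; first by split; lin.
split; [by rewrite memvD ?memvZ | by rewrite hFD F0 G0 scaler0 addr0 |].
by move=> z; have := Fo z; have := Go z; rewrite /omega triDE triZE => -> ->; rewrite mulr0 addr0.
Qed.
Definition vcalF : {vspace T} := subspace vcalF_linear.

Definition is_calF2 F : Prop := F \in calF /\ F = F7 F.
Lemma calF2_linear : linear_subset is_calF2.
Proof.
split=> [|a F G [FF F1] [GG G1]]; first by split; lin.
by split; [rewrite memvD ?memvZ | rewrite F7D -F1 -G1].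
Qed.
Definition calF2 : {vspace T} := subspace calF2_linear.

Definition is_calF3 F : Prop := F \in calF /\ F = F8 F.
Lemma calF3_linear : linear_subset is_calF3.
Proof.
split=> [|a F G [FF F1] [GG G1]]; first by split; lin.
by split; [rewrite memvD ?memvZ | rewrite F8D -F1 -G1].
Qed.
Definition calF3 : {vspace T} := subspace calF3_linear.

Definition is_calF4 F : Prop := [/\ F \in calF, F = F4 F, F = F5 F & ftrace F ξ = 0].
Lemma calF4_linear : linear_subset is_calF4.
Proof.
split=> [|a F G [FF F1 F2 F3] [GG G1 G2 G3]].
  by split; lin; rewrite /ftrace big1.
split; [by rewrite memvD ?memvZ | by rewrite F4D -F1 -G1
  | by rewrite F5D -F2 -G2 | by rewrite ftraceD F3 G3 mulr0 addr0].
Qed.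
Definition calF4 : {vspace T} := subspace calF4_linear.

Definition is_calF5 F : Prop := [/\ F \in calF, F = F4 F, F = - F5 F & fstar F ξ = 0].
Lemma calF5_linear : linear_subset is_calF5.
Proof.
split=> [|a F G [FF F1 F2 F3] [GG G1 G2 G3]].
  by split; lin; rewrite /fstar big1.
split; [by rewrite memvD ?memvZ | by rewrite F4D -F1 -G1
  | by rewrite F5D opprD -scalerN -F2 -G2 | by rewrite fstarD F3 G3 mulr0 addr0].
Qed.
Definition calF5 : {vspace T} := subspace calF5_linear.

Definition is_calF6 F : Prop := [/\ F \in calF, F = - F4 F & F = F5 F].
Lemma calF6_linear : linear_subset is_calF6.
Proof.
split=> [|a F G [FF F1 F2] [GG G1 G2]]; first by split; lin.
by split; [rewrite memvD ?memvZ | rewrite F4D opprD -scalerN -F1 -G1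
  | rewrite F5D -F2 -G2].
Qed.
Definition calF6 : {vspace T} := subspace calF6_linear.

Definition is_calF7 F : Prop := [/\ F \in calF, F = - F4 F & F = - F5 F].
Lemma calF7_linear : linear_subset is_calF7.
Proof.
split=> [|a F G [FF F1 F2] [GG G1 G2]]; first by split; lin.
by split; [rewrite memvD ?memvZ | rewrite F4D opprD -scalerN -F1 -G1
  | rewrite F5D opprD -scalerN -F2 -G2].
Qed.
Definition calF7 : {vspace T} := subspace calF7_linear.

Definition is_calF8 F : Prop := [/\ F \in calF, hF F = 0 & forall x y, F x y ξ = 0].
Lemma calF8_linear : linear_subset is_calF8.
Proof.
split=> [|a F G [FF F0 F1] [GG G0 G1]]; first by split; lin.
split; [by rewrite memvD ?memvZ | by rewrite hFD F0 G0 scaler0 addr0 |].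
by move=> x y; rewrite triDE triZE F1 G1 mulr0 addr0.
Qed.
Definition calF8 : {vspace T} := subspace calF8_linear.

Definition summand (i : nat) : {vspace T} :=
  match i with
  | 2 => calF2 | 3 => calF3 | 4 => calF4 | 5 => calF5
  | 6 => calF6 | 7 => calF7 | 8 => calF8
  | _ => 0%VS
  end.

Definition orthogonal_spaces (U W : {vspace T}) : Prop :=
  forall F G, F \in U -> G \in W -> inner F G = 0.

Definition is_orthogonal_projection (U : {vspace T}) F P : Prop :=
  P \in U /\ forall G, G \in U -> inner (F - P) G = 0.

(* Elements of the group U(n) x 1. *)
Definition in_Un1 (a : 'End(V)) : Prop :=
  [/\ bijective a,
      forall x, a (φ x) = φ (a x),
      a ξ = ξ,
      forall x, η (a x) = η x &
      forall x y, g (a x) (a y) = g x y].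

Lemma act_trilinear (a : 'End(V)) F :
  trilinear (fun x y z => F ((a^-1)%VF x) ((a^-1)%VF y) ((a^-1)%VF z)).
Proof. by split=> *; rewrite linearP ?(triDl, triDm, triDr). Qed.
Definition act (a : 'End(V)) F : T := Trilinear (act_trilinear a F).

End Operators.

(* Main.v *)
Require Import Defs.
From HB Require Import structures.
From mathcomp Require Import all_boot all_order all_algebra.
From mathcomp Require Import reals.
From mathcomp Require Import ring lra.

Set Implicit Arguments.
Unset Strict Implicit.
Unset Printing Implicit Defensive.

Import Order.TTheory GRing.Theory Num.Theory.
Local Open Scope ring_scope.

(** A form [F] in [calF] splits as [hF F + F2 F + (F1 F - F3 F)]
    ([calF_decomp]): the first term only sees horizontal arguments, the second
    the values of [F] with [xi] in the second or third slot, the third those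
    with [xi] in the first slot alone. When [hF F = 0] and [omega F = 0], the
    correction [F3 F] vanishes, and what remains is [F1 F], which is the part in
    [calF8], and [F2 F], which is determined by the bilinear form
    [b x z = F x xi z].

    On [b] there are two commuting involutions, [b (phi x) (phi z)] and
    [b z x]. In terms of forms these are [F4] and [F5]: on [calF], the operators
    [F2 - F3], [F4], [F5] and [F6 = F4 o F5] multiply like the Klein four-group
    with [F2 - F3] as its identity (the lemmas [F4_F4], [F5_F5] and their
    neighbours). Hence [F2 F - F3 F] is the sum of four simultaneous
    eigenvectors [eigenproj a b F], one for each pair of signs; the four factors
    [4^-1] of the theorem are the factors of these character projections. The
    [(-,+)] and [(-,-)] parts are [calF6] and [calF7]. The [(+,+)] part contains
    the multiples of the horizontal metric, whose coefficient is read off by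
    [ftrace F xi], and the [(+,-)] part contains the multiples of the fundamental
    two-form, whose coefficient is read off by [fstar F xi]; splitting off these
    lines, which are [calF2] and [calF3], leaves [calF4] and [calF5].

    The three linear functionals [ftrace _ xi], [fstar _ xi] and
    [inner _ G], for [G] an eigenvector, are eigenvectors of the transposed
    operators ([ftrace_character], [fstar_character], [inner_character]), and
    such a functional sees only the part with its own signs
    ([character_eigenproj]). This gives at once the memberships, the
    orthogonality of different parts, and the fact that the stated formulas are
    orthogonal projections. The eigenvector property itself is a statement about
    adjoints: [phi] is skew, and a trace over an orthonormal basis lets an
    operator pass to the other slot as its adjoint ([sum_adjoint]). The same
    lemma makes the two traces invariant under [U(n) x 1], after which invariance
    of the summands holds because the defining operators commute with the
    action. Finally, orthogonality and positivity of [inner] make the sum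
    direct. *)

(** * Trilinear forms on an almost contact metric space *)

Section TrilinearArguments.
Variables (R : realType) (V : vectType R).
Implicit Types F G : trilinear_form V.

Lemma tri0l F y z : F 0 y z = 0.
Proof. by have := triDl F (-1) 0 0 y z; rewrite scaler0 addr0 mulN1r addNr. Qed.
Lemma tri0m F x z : F x 0 z = 0.
Proof. by have := triDm F (-1) x 0 0 z; rewrite scaler0 addr0 mulN1r addNr. Qed.
Lemma tri0r F x y : F x y 0 = 0.
Proof. by have := triDr F (-1) x y 0 0; rewrite scaler0 addr0 mulN1r addNr. Qed.

Definition triE := (@triDE R V, @triNE R V, @triZE R V, @tri0E R V).

End TrilinearArguments.

Section AlmostContact.
Variables (R : realType) (V : vectType R) (A : almost_contact_metric V).
Local Notation φ := (phi A).
Local Notation ξ := (xi A).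
Local Notation η := (Defs.eta A).
Local Notation g := (met A).
Implicit Types F G : trilinear_form V.

Lemma eta_xi : η ξ = 1.
Proof.
have := phi_phi A ξ; rewrite !phi_xi linear0.
move/eqP; rewrite eq_sym addrC subr_eq0 => /eqP E.
have := met_xi A; rewrite -{1}E linearZl_LR /= => H.
by have := met_xi A; move: H => /[swap] ->; rewrite mulr1.
Qed.

Lemma met_sym x y : g x y = g y x.
Proof. by rewrite hermC /= mul1r. Qed.

Lemma met_xir x : g x ξ = η x.
Proof. by have := met_phi A x ξ; rewrite phi_xi linear0r eta_xi mulr1; lra. Qed.

Lemma met_xil x : g ξ x = η x.
Proof. by rewrite met_sym met_xir. Qed.

Lemma met_phi2l x y : g (φ (φ x)) y = - g x y + η x * η y.
Proof. by rewrite phi_phi -scaleN1r metDl linearZl_LR /= met_xil mulN1r. Qed.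

Lemma met_phi2r x y : g x (φ (φ y)) = - g x y + η x * η y.
Proof. by rewrite met_sym met_phi2l met_sym mulrC. Qed.

(** Apply the compatibility of the metric with [phi] to the pair [x], [phi y]
    and use [phi (phi y) = - y + eta y *: xi], where [xi] is orthogonal to the
    range of [phi]. *)
Lemma phi_skew x y : g (φ x) y = - g x (φ y).
Proof.
have := met_phi A x (φ y); rewrite eta_phi mulr0 subr0 => <-.
by rewrite met_phi2r eta_phi mul0r addr0 opprK.
Qed.

Lemma tri_phi2l F x y z : F (φ (φ x)) y z = - F x y z + η x * F ξ y z.
Proof. by rewrite phi_phi -scaleN1r -[η x *: _]addr0 !triDl tri0l mulN1r addr0. Qed.
Lemma tri_phi2m F x y z : F x (φ (φ y)) z = - F x y z + η y * F x ξ z.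
Proof. by rewrite phi_phi -scaleN1r -[η y *: _]addr0 !triDm tri0m mulN1r addr0. Qed.
Lemma tri_phi2r F x y z : F x y (φ (φ z)) = - F x y z + η z * F x y ξ.
Proof. by rewrite phi_phi -scaleN1r -[η z *: _]addr0 !triDr tri0r mulN1r addr0. Qed.

(** Normalises the values of trilinear forms built from the contact structure:
    [eta] and [phi] are evaluated on [xi], and [phi] is reduced to first powers. *)
Definition contactE := (eta_xi, @eta_phi R V A, phi_xi A, @tri0l R V, @tri0m R V,
  @tri0r R V, tri_phi2l, tri_phi2m, tri_phi2r, met_xir, met_xil).

Lemma calFP F : F \in calF A <-> is_calF A F.
Proof. exact: mem_subspace. Qed.

Lemma calF_skew F x y z : F \in calF A -> F x y z = - F x z y.
Proof. by case/calFP. Qed.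

Lemma calF_xixi F x : F \in calF A -> F x ξ ξ = 0.
Proof. by move=> hF; have := calF_skew x ξ ξ hF; lra. Qed.

Lemma calF_xir F x y : F \in calF A -> F x y ξ = - F x ξ y.
Proof. exact: calF_skew. Qed.

Lemma calF_phi F x y z : F \in calF A ->
  F x (φ y) (φ z) = - F x y z + η y * F x ξ z - η z * F x ξ y.
Proof.
move=> hF; have [_ H] := (calFP F).1 hF.
by have := H x y z; rewrite (calF_xir x y hF); lra.
Qed.

(** A form [eta y * b x z - eta z * b x y] with [b x xi = 0] vanishes on pairs
    [phi y], [phi z], which makes the second defining identity of [calF]
    automatic. All the operators of the theorem except [F1] and [hF] produce such
    forms, so this is how their values are shown to lie in [calF]. *)
Lemma calF_F2 F : F = F2 A F -> F \in calF A.
Proof.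
move=> E; have H x y z : F x y z = η y * F x ξ z - η z * F x ξ y by rewrite {1}E.
have H0 x : F x ξ ξ = 0 by rewrite H; ring.
apply/calFP; split=> x y z; first by rewrite H (H x z y); ring.
by rewrite (H x y z) (H x (φ y)) (H x y ξ) H0 !contactE; ring.
Qed.

Lemma F2_idem F : F \in calF A -> F2 A (F2 A F) = F2 A F.
Proof. by move=> hF; apply: triP => x y z /=; rewrite !(calF_xixi _ hF) !contactE; ring. Qed.
Lemma F2_F3 F : F \in calF A -> F2 A (F3 A F) = F3 A F.
Proof. by move=> hF; apply: triP => x y z /=; rewrite !(calF_xixi _ hF) !contactE; ring. Qed.
Lemma F2_F4 F : F2 A (F4 A F) = F4 A F.
Proof. by apply: triP => x y z /=; rewrite !contactE; ring. Qed.
Lemma F2_F5 F : F2 A (F5 A F) = F5 A F.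
Proof. by apply: triP => x y z /=; rewrite !contactE; ring. Qed.
Lemma F4_F5 F : F4 A (F5 A F) = F6 A F.
Proof. by apply: triP => x y z /=; rewrite !contactE; ring. Qed.
Lemma F4_F2 F : F4 A (F2 A F) = F4 A F.
Proof. by apply: triP => x y z /=; rewrite !contactE; ring. Qed.
Lemma F4_F3 F : F4 A (F3 A F) = 0.
Proof. by apply: triP => x y z /=; rewrite !contactE; ring. Qed.
(** Applying [phi] twice to both slots of [F x xi z] projects them off [xi]. The
    value at [z = xi] is zero by skewness, while the value at [x = xi] is
    [omega F z]: the correction [F3]. *)
Lemma F4_F4 F : F \in calF A -> F4 A (F4 A F) = F2 A F - F3 A F.
Proof.
move=> hF; apply: triP => x y z; rewrite ?triE /= !contactE.
by rewrite ?(calF_xixi _ hF); ring.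
Qed.
Lemma F4_F6 F : F \in calF A -> F4 A (F6 A F) = F5 A F.
Proof.
move=> hF; apply: triP => x y z; rewrite ?triE /= !contactE.
by rewrite ?(calF_xixi _ hF); ring.
Qed.
Lemma F5_F2 F : F \in calF A -> F5 A (F2 A F) = F5 A F.
Proof.
move=> hF; apply: triP => x y z; rewrite ?triE /= !contactE.
by rewrite ?(calF_xixi _ hF); ring.
Qed.
Lemma F5_F3 F : F \in calF A -> F5 A (F3 A F) = 0.
Proof.
move=> hF; apply: triP => x y z; rewrite ?triE /= !contactE.
by rewrite ?(calF_xixi _ hF); ring.
Qed.
Lemma F5_F4 F : F5 A (F4 A F) = F6 A F.
Proof. by apply: triP => x y z /=; rewrite !contactE; ring. Qed.
Lemma F5_F5 F : F \in calF A -> F5 A (F5 A F) = F2 A F - F3 A F.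
Proof.
move=> hF; apply: triP => x y z; rewrite ?triE /= !contactE.
by rewrite ?(calF_xixi _ hF); ring.
Qed.
Lemma F5_F6 F : F \in calF A -> F5 A (F6 A F) = F4 A F.
Proof.
by move=> hF; apply: triP => x y z; rewrite ?triE /= !contactE; ring.
Qed.

End AlmostContact.

(** * Sums over an orthonormal basis *)

Section OrthonormalSums.
Variables (R : realType) (V : vectType R) (A : almost_contact_metric V).
Variables (n : nat) (e : (2 * n).+1.-tuple V).
Hypothesis e_orth : orthonormal_basis A e.
Local Notation φ := (phi A).
Local Notation ξ := (xi A).
Local Notation η := (Defs.eta A).
Local Notation g := (met A).
Implicit Types (F G : trilinear_form V) (p : V -> R) (B : V -> V -> R).

(** Plain functions rather than bundled bilinear maps, because the instances
    below are partial applications of trilinear forms twisted by [phi] or by an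
    isometry. *)
Definition bilinear_fun B := (forall y, scalar (B^~ y)) /\ (forall x, scalar (B x)).

Lemma sum_met p y : scalar p -> \sum_(x <- e) g x y * p x = p y.
Proof.
move=> pL; have [eB eO] := e_orth.
have p0 : p 0 = 0 by have := pL (-1) 0 0; rewrite scaler0 addr0 mulN1r addNr.
have {2}-> := coord_basis eB (memvf y).
have -> : p (\sum_i coord e i y *: e`_i) = \sum_i coord e i y * p e`_i.
  by elim/big_rec2: _ => // i a b _ <-; rewrite pL.
rewrite big_tuple; apply: eq_bigr => i _; rewrite -tnth_nth; congr (_ * _).
rewrite {1}[y](coord_basis eB (memvf y)) linear_sumr (bigD1 i) //=.
rewrite linearZr_LR /= -tnth_nth eO eqxx mulr1 big1 ?addr0 // => j ne.
by rewrite linearZr_LR /= -tnth_nth eO eq_sym (negPf ne) mulr0.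
Qed.

Lemma sum_eta p : scalar p -> \sum_(x <- e) η x * p x = p ξ.
Proof.
by move=> pL; rewrite -(sum_met ξ pL); apply: eq_bigr => x _; rewrite met_xir.
Qed.

(** Expand [L x] in the basis, exchange the two sums, and use that the
    coefficient [g y (L x)] is also that of [M y] at [x]. *)
Lemma sum_adjoint B (L M : V -> V) : bilinear_fun B ->
  (forall x y, g (L x) y = g x (M y)) ->
  \sum_(x <- e) B (L x) x = \sum_(x <- e) B x (M x).
Proof.
move=> [Bl Br] LM.
under eq_bigr => x _ do rewrite -(sum_met (L x) (Bl x)).
rewrite exchange_big /=; apply: eq_bigr => y _.
rewrite -(sum_met (M y) (Br y)); apply: eq_bigr => x _.
by rewrite met_sym LM.
Qed.

Lemma sum_phi B : bilinear_fun B ->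
  \sum_(x <- e) B (φ x) x = - \sum_(x <- e) B x (φ x).
Proof.
move=> BB; rewrite (@sum_adjoint _ φ (fun x => - φ x)) //.
  rewrite -sumrN; apply: eq_bigr => x _.
  by have := BB.2 x (-1) (φ x) 0; rewrite addr0 scaleN1r mulN1r => ->;
    have := BB.2 x (-1) 0 0; rewrite scaler0 addr0 mulN1r addNr => ->; rewrite addr0.
by move=> x y; rewrite phi_skew linearNr.
Qed.

Lemma sum_met_diag : \sum_(x <- e) g x x = (2 * n).+1%:R.
Proof.
rewrite big_tuple (eq_bigr (fun=> 1)) ?sumr_const ?card_ord // => i _.
by rewrite e_orth.2 eqxx.
Qed.

Lemma tri_scalarl F y z : scalar (fun x => F x y z).
Proof. by move=> a u v; rewrite triDl. Qed.
Lemma tri_scalarm F x z : scalar (fun y => F x y z).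
Proof. by move=> a u v; rewrite triDm. Qed.
Lemma tri_scalarr F x y : scalar (fun z => F x y z).
Proof. by move=> a u v; rewrite triDr. Qed.
Lemma tri_bilinear F y : bilinear_fun (fun x z => F x y z).
Proof. by split=> w a u v; rewrite ?triDl ?triDr. Qed.

Lemma mul_bilinear p q : scalar p -> scalar q -> bilinear_fun (fun x y => p x * q y).
Proof.
move=> pL qL; split=> w a u v; rewrite ?pL ?qL; ring.
Qed.

Lemma innerC F G : inner e F G = inner e G F.
Proof. by do 3!apply: eq_bigr => ? _; rewrite mulrC. Qed.

Lemma innerDl F G H : inner e (F + G) H = inner e F H + inner e G H.
Proof. by do 3!(rewrite -big_split; apply: eq_bigr => ? _); rewrite triDE /= mulrDl. Qed.
Lemma innerZl a F H : inner e (a *: F) H = a * inner e F H.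
Proof. by do 3!(rewrite mulr_sumr; apply: eq_bigr => ? _); rewrite triZE mulrA. Qed.
Lemma innerNl F H : inner e (- F) H = - inner e F H.
Proof. by rewrite -scaleN1r innerZl mulN1r. Qed.
Lemma inner0l H : inner e 0 H = 0.
Proof. by rewrite -(scale0r (0 : trilinear_form V)) innerZl mul0r. Qed.

Definition innerlE := (innerDl, innerNl, innerZl, inner0l).

Lemma inner_eq0 F : inner e F F = 0 -> F = 0.
Proof.
have ge0 (x y : V) : 0 <= \sum_(z <- e) F x y z * F x y z.
  by apply: sumr_ge0 => z _; rewrite -expr2 sqr_ge0.
move=> /eqP; rewrite psumr_eq0; last by move=> x _; apply: sumr_ge0.
move=> /allP H1; have F0 x y z : x \in e -> y \in e -> z \in e -> F x y z = 0.
  move=> xe ye ze; have := H1 _ xe; rewrite psumr_eq0 => [|y' _]; last exact: ge0.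
  move=> /allP /(_ _ ye) /=; rewrite psumr_eq0 => [|z' _]; last by rewrite -expr2 sqr_ge0.
  move=> /allP /(_ _ ze) /=.
  by rewrite mulf_eq0 orbb => /eqP.
apply: triP => x y z.
rewrite -(sum_met x (tri_scalarl F y z)) big_seq big1 // => x' xe.
rewrite -(sum_met y (tri_scalarm F x' z)) big_seq big1 ?mulr0 // => y' ye.
rewrite -(sum_met z (tri_scalarr F x' y')) big_seq big1 ?mulr0 // => z' ze.
by rewrite F0 // mulr0.
Qed.

(** The sum over the slot that carries [eta] evaluates that slot at [xi]. The two
    terms of [F2 G] contribute equally because [F] is skew in its last two slots,
    hence the factor [2]. *)
Lemma inner_vertical F G : (forall x y z, F x y z = - F x z y) -> G = F2 A G ->
  inner e F G = 2 * \sum_(x <- e) \sum_(z <- e) F x ξ z * G x ξ z.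
Proof.
move=> skew GV; rewrite mulr_sumr; apply: eq_bigr => x _.
set S := \sum_(z <- e) F x ξ z * G x ξ z; transitivity (S + S); last by rewrite mulr_natl mulr2n.
transitivity (\sum_(y <- e) (\sum_(z <- e) F x y z * (η y * G x ξ z))
   - \sum_(y <- e) (\sum_(z <- e) F x y z * (η z * G x ξ y))).
  rewrite -sumrB; apply: eq_bigr => y _; rewrite -sumrB.
  by apply: eq_bigr => z _; rewrite {1}GV /=; ring.
rewrite -[RHS]/(S + S); congr (_ + _).
  rewrite exchange_big; apply: eq_bigr => z _ /=.
  rewrite -(sum_eta (tri_scalarm F x z)) mulr_suml.
  by apply: eq_bigr => y _; ring.
rewrite -sumrN; apply: eq_bigr => y _ /=.
rewrite (skew x ξ) -(sum_eta (tri_scalarr F x y)) mulNr mulr_suml; congr (- _).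
by apply: eq_bigr => z _; ring.
Qed.

End OrthonormalSums.

(** * The Klein four-group of operators and its eigenspaces *)

Section Projections.
Variables (R : realType) (V : vectType R) (A : almost_contact_metric V).
Variables (n : nat) (e : (2 * n).+1.-tuple V).
Hypotheses (n_ge1 : (1 <= n)%N) (e_orth : orthonormal_basis A e).
Local Notation φ := (phi A).
Local Notation ξ := (xi A).
Local Notation η := (Defs.eta A).
Local Notation g := (met A).
Implicit Types (F G : trilinear_form V) (a b : bool).

(** The simultaneous eigenspace of [F4] and [F5], with the signs encoded by
    booleans. *)
Definition eigenpart a b F : Prop :=
  [/\ F \in calF A, F4 A F = (-1) ^+ a *: F & F5 A F = (-1) ^+ b *: F].

(** Any value of [F4] is fixed by [F2], and an eigenvector of [F4] for a sign is
    up to that sign a value of [F4]. *)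
Lemma eigenpart_F2 a b F : eigenpart a b F -> F = F2 A F.
Proof.
move=> [_ E4 _]; have -> : F = (-1) ^+ a *: F4 A F.
  by rewrite E4 scalerA -signr_addb addbb scale1r.
by apply: triP => x y z; rewrite !triE /= ?triE /= !contactE; ring.
Qed.

Lemma eigenpart_phi a b F x z : eigenpart a b F ->
  F (φ x) ξ (φ z) = (-1) ^+ a * F x ξ z.
Proof.
move=> [_ E4 _]; rewrite -triZE -E4 /= !contactE; ring.
Qed.

(** [F4] kills the value at [x = xi] because [phi xi = 0]. *)
Lemma eigenpart_xi a b F z : eigenpart a b F -> F ξ ξ z = 0.
Proof.
move=> EF; have := eigenpart_phi ξ z EF; rewrite !contactE => /esym/eqP.
by rewrite mulf_eq0 signr_eq0 => /eqP.
Qed.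

Lemma F2_skew F x y z : F2 A F x y z = - F2 A F x z y.
Proof. by rewrite /=; ring. Qed.

Lemma F2_F6 F : F2 A (F6 A F) = F6 A F.
Proof. by rewrite -F4_F5 F2_F4. Qed.

(** The multiplication table of the operators on [calF]. *)
Definition kleinE F (hF : F \in calF A) :=
  (F2_idem hF, F2_F3 hF, F2_F4 A F, F2_F5 A F, F2_F6 F, F4_F2 A F, F4_F3 A F, F4_F4 hF,
   F4_F5 A F, F4_F6 hF, F5_F2 hF, F5_F3 hF, F5_F4 A F, F5_F5 hF, F5_F6 hF).

Lemma F2D (c : R) F G : F2 A (c *: F + G) = c *: F2 A F + F2 A G.
Proof. by apply: triP => x y z; rewrite /= ?triE /=; ring. Qed.

(** The average of the group elements [F2 - F3], [F4], [F5], [F6] weighted by the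
    character with signs [a], [b]. The nested shape lets the law
    [o (c *: F + G) = c *: o F + o G] of the operators apply term by term. *)
Definition eigenproj a b F : trilinear_form V :=
  4^-1 *: ((-1) ^+ a *: F4 A F + ((-1) ^+ b *: F5 A F +
    ((-1) ^+ (a (+) b) *: F6 A F + ((-1) *: F3 A F + F2 A F)))).

Lemma eigenproj_op (o : trilinear_form V -> trilinear_form V) a b F :
  (forall (c : R) G H, o (c *: G + H) = c *: o G + o H) ->
  o (eigenproj a b F) = 4^-1 *: ((-1) ^+ a *: o (F4 A F) + ((-1) ^+ b *: o (F5 A F) +
    ((-1) ^+ (a (+) b) *: o (F6 A F) + ((-1) *: o (F3 A F) + o (F2 A F))))).
Proof.
by move=> oD; rewrite /eigenproj -[4^-1 *: _]addr0 !oD linear_op0 // addr0.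
Qed.

Lemma eigenproj_calF a b F : F \in calF A -> eigenproj a b F \in calF A.
Proof.
move=> hF; apply: calF_F2; rewrite eigenproj_op; last exact: F2D.
by rewrite !(kleinE hF).
Qed.

Lemma eigenproj_eigenpart a b F : F \in calF A -> eigenpart a b (eigenproj a b F).
Proof.
move=> hF; split; first exact: eigenproj_calF.
  rewrite eigenproj_op ?(kleinE hF); last exact: F4D.
  by apply: triP => x y z; rewrite ?triE; case: a; case: b; rewrite /= ?expr1 ?expr0; ring.
rewrite eigenproj_op ?(kleinE hF); last exact: F5D.
by apply: triP => x y z; rewrite ?triE; case: a; case: b; rewrite /= ?expr1 ?expr0; ring.
Qed.

Lemma ftrace_xi F : F \in calF A -> ftrace e F ξ = - \sum_(x <- e) F x ξ x.
Proof. by move=> hF; rewrite -sumrN; apply: eq_bigr => x _; exact: calF_xir. Qed.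
Lemma fstar_xi F : F \in calF A -> fstar A e F ξ = - \sum_(x <- e) F x ξ (φ x).
Proof. by move=> hF; rewrite -sumrN; apply: eq_bigr => x _; exact: calF_xir. Qed.

Lemma calF_klein F : F \in calF A ->
  [/\ F2 A F \in calF A, F3 A F \in calF A, F4 A F \in calF A,
      F5 A F \in calF A & F6 A F \in calF A].
Proof.
by move=> hF; split; apply: calF_F2; rewrite ?(kleinE hF).
Qed.

Lemma calF_F7 F : F7 A e F \in calF A.
Proof.
by apply: calF_F2; apply: triP => x y z /=; rewrite ?contactE; ring.
Qed.

Lemma calF_F8 F : F8 A e F \in calF A.
Proof.
by apply: calF_F2; apply: triP => x y z /=; rewrite ?contactE ?linear0r; ring.
Qed.

Lemma ftrace_F2 F : F \in calF A -> ftrace e (F2 A F) ξ = ftrace e F ξ.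
Proof.
move=> hF; rewrite /ftrace; apply: eq_bigr => x _ /=.
by rewrite (calF_xixi _ hF) (calF_xir _ _ hF) !contactE; ring.
Qed.

Lemma fstar_F2 F : F \in calF A -> fstar A e (F2 A F) ξ = fstar A e F ξ.
Proof.
move=> hF; rewrite /fstar; apply: eq_bigr => x _ /=.
by rewrite (calF_xixi _ hF) (calF_xir _ _ hF) !contactE; ring.
Qed.

(** Both traces below are computed on [b x z = F x xi z]: replacing [b] by its
    [phi]-twist moves one [phi] across the trace, where the sign of its skewness
    cancels that of [phi (phi x)], up to a term in [F x xi xi = 0]. *)
Lemma ftrace_F4 F : F \in calF A -> ftrace e (F4 A F) ξ = ftrace e F ξ.
Proof.
move=> hF; have [_ _ h4 _ _] := calF_klein hF.
rewrite !ftrace_xi //; congr (- _).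
transitivity (\sum_(x <- e) F (φ x) ξ (φ x)).
  by apply: eq_bigr => x _ /=; rewrite !contactE; ring.
have B : bilinear_fun (fun x z => F x ξ (φ z)).
  by split=> w c u v; rewrite ?linearP ?triDl ?triDr.
rewrite (sum_phi e_orth B) -sumrN; apply: eq_bigr => x _.
by rewrite !contactE (calF_xixi _ hF); ring.
Qed.

Lemma fstar_F4 F : F \in calF A -> fstar A e (F4 A F) ξ = fstar A e F ξ.
Proof.
move=> hF; have [_ _ h4 _ _] := calF_klein hF.
rewrite !fstar_xi //; congr (- _).
transitivity (\sum_(x <- e) - F (φ x) ξ x).
  by apply: eq_bigr => x _ /=; rewrite !contactE (calF_xixi _ hF); ring.
by rewrite sumrN (sum_phi e_orth (tri_bilinear F ξ)) opprK.
Qed.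

Lemma ftrace_F5 F : F \in calF A -> ftrace e (F5 A F) ξ = ftrace e F ξ.
Proof.
move=> hF; have [_ _ _ h5 _] := calF_klein hF.
rewrite !ftrace_xi //; congr (- _).
transitivity (\sum_(x <- e) (F x ξ x - η x * F ξ ξ x)).
  by apply: eq_bigr => x _ /=; rewrite !contactE; ring.
by rewrite sumrB (sum_eta e_orth (tri_scalarr F ξ ξ)) calF_xixi // subr0.
Qed.

(** Transposing [b] moves [phi] to the other slot, which costs a sign. *)
Lemma fstar_F5 F : F \in calF A -> fstar A e (F5 A F) ξ = - fstar A e F ξ.
Proof.
move=> hF; have [_ _ _ h5 _] := calF_klein hF.
rewrite !fstar_xi // opprK -(opprK (\sum_(x <- e) F x _ _)).
rewrite -(sum_phi e_orth (tri_bilinear F ξ)); congr (- _).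
by apply: eq_bigr => x _ /=; rewrite !contactE; ring.
Qed.

(** Linear functionals that transform under the four-group by a character; being
    so is what makes a functional vanish on the other eigenspaces. *)
Definition character a b (L : trilinear_form V -> R) : Prop :=
  scalar L /\ forall F, F \in calF A ->
    [/\ L (F2 A F) = L F, L (F4 A F) = (-1) ^+ a * L F & L (F5 A F) = (-1) ^+ b * L F].

Lemma ftrace_character : character false false (fun F => ftrace e F ξ).
Proof.
split=> [c F G|F hF]; first exact: ftraceD.
by rewrite ftrace_F2 // ftrace_F4 // ftrace_F5 // mul1r.
Qed.

Lemma fstar_character : character false true (fun F => fstar A e F ξ).
Proof.
split=> [c F G|F hF]; first exact: fstarD.
by rewrite fstar_F2 // fstar_F4 // fstar_F5 // mul1r mulN1r.
Qed.

Lemma character_F3 a b L F : character a b L -> F \in calF A -> L (F3 A F) = 0.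
Proof.
move=> [LD LK] hF; have [_ _ h4 _ _] := calF_klein hF.
have -> : F3 A F = (-1) *: F4 A (F4 A F) + F2 A F.
  by rewrite F4_F4 // scaleN1r opprB subrK.
rewrite LD; case: (LK _ h4) => _ -> _; case: (LK _ hF) => -> -> _.
by rewrite mulrA -signr_addb addbb mul1r mulN1r addNr.
Qed.

(** Orthogonality of characters of the Klein four-group. *)
Lemma character_eigenproj a b a' b' L F : character a b L -> F \in calF A ->
  L (eigenproj a' b' F) = ((a == a') && (b == b'))%:R * L F.
Proof.
move=> LC hF; have [LD LK] := LC; have [_ _ _ h5 _] := calF_klein hF.
have L0 : L 0 = 0 by have := LD (-1) 0 0; rewrite scaler0 addr0 mulN1r addNr.
rewrite /eigenproj -[4^-1 *: _]addr0 !LD L0 (character_F3 LC hF).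
rewrite -F4_F5; case: (LK _ h5) => _ -> _; case: (LK _ hF) => -> -> ->.
by case: a {LC LK}; case: b; case: a'; case: b'; rewrite /= ?expr1 ?expr0; field.
Qed.

(** The skew map [phi] is moved across in each of the two slots, and the two signs
    cancel. *)
Lemma inner_F4 F G : F \in calF A -> G = F2 A G -> 
  inner e (F4 A F) G = inner e F (F4 A G).
Proof.
move=> hF GV; have [_ _ h4 _ _] := calF_klein hF.
have hG := calF_F2 GV; have V4 : F4 A G = F2 A (F4 A G) by rewrite F2_F4.
rewrite (inner_vertical e_orth (fun x y z => calF_skew x y z h4) GV).
rewrite (inner_vertical e_orth (fun x y z => calF_skew x y z hF) V4).
congr (_ * _).
transitivity (\sum_(x <- e) \sum_(z <- e) F (φ x) ξ (φ z) * G x ξ z).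
  by apply: eq_bigr => x _; apply: eq_bigr => z _ /=; rewrite !contactE; ring.
transitivity (\sum_(x <- e) \sum_(z <- e) - (F (φ x) ξ z * G x ξ (φ z))).
  apply: eq_bigr => x _; rewrite sumrN.
  exact: (sum_phi e_orth (mul_bilinear (tri_scalarr F _ _) (tri_scalarr G _ _))).
rewrite exchange_big [RHS]exchange_big; apply: eq_bigr => z _ /=.
rewrite sumrN.
rewrite (sum_phi e_orth (mul_bilinear (tri_scalarl F _ _) (tri_scalarl G _ _))).
by rewrite opprK; apply: eq_bigr => x _; rewrite !contactE; ring.
Qed.

Lemma inner_F5 F G : F \in calF A -> G = F2 A G -> (forall z, G ξ ξ z = 0) ->
  inner e (F5 A F) G = inner e F (F5 A G).
Proof.
move=> hF GV Gxi; have [_ _ _ h5 _] := calF_klein hF.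
have hG := calF_F2 GV; have V5 : F5 A G = F2 A (F5 A G) by rewrite F2_F5.
rewrite (inner_vertical e_orth (fun x y z => calF_skew x y z h5) GV).
rewrite (inner_vertical e_orth (fun x y z => calF_skew x y z hF) V5).
congr (_ * _).
transitivity (\sum_(x <- e) \sum_(z <- e) F z ξ x * G x ξ z).
  apply: eq_bigr => x _; transitivity
    (\sum_(z <- e) (F z ξ x * G x ξ z - η z * (F ξ ξ x * G x ξ z))).
    by apply: eq_bigr => z _ /=; rewrite !contactE; ring.
  rewrite sumrB (sum_eta e_orth (p := fun z => F ξ ξ x * G x ξ z)).
    by rewrite calF_xixi // mulr0 subr0.
  by move=> c u v; rewrite triDr; ring.
rewrite exchange_big; apply: eq_bigr => z _; apply: eq_bigr => x _ /=.
by rewrite !contactE Gxi; ring.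
Qed.

Lemma inner_F2 F G : F \in calF A -> G = F2 A G -> inner e (F2 A F) G = inner e F G.
Proof.
move=> hF GV.
rewrite (inner_vertical e_orth (F2_skew F) GV).
rewrite (inner_vertical e_orth (fun x y z => calF_skew x y z hF) GV).
congr (_ * _); apply: eq_bigr => x _; apply: eq_bigr => z _ /=.
by rewrite calF_xixi // !contactE; ring.
Qed.

Lemma inner_character a b G : eigenpart a b G -> character a b (fun F => inner e F G).
Proof.
move=> EG; have [_ G4 G5] := EG; have GV := eigenpart_F2 EG.
split=> [c F H|F hF]; first by rewrite innerDl innerZl.
rewrite inner_F2 // inner_F4 // inner_F5 //; last by move=> z; exact: eigenpart_xi EG.
by rewrite G4 G5 ![inner _ F _]innerC !innerZl.
Qed.

Lemma eigenpart_ortho a b a' b' F G : eigenpart a b F -> eigenpart a' b' G ->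
  (a, b) != (a', b') -> inner e F G = 0.
Proof.
move=> EF EG ne; have [hF F4F F5F] := EF.
have [_ /(_ F hF) [_]] := inner_character EG; rewrite F4F F5F !innerZl.
move: ne; rewrite -pair_eqE /=.
case: a b a' b' {EF EG F4F F5F} => [] [] [] [] //= _;
  rewrite ?expr1 ?expr0 => e4 e5; lra.
Qed.

(** The horizontal metric is symmetric and invariant under [phi]. *)
Lemma F7_eigenpart F : eigenpart false false (F7 A e F).
Proof.
split; first exact: calF_F7.
  apply: triP => x y z; rewrite ?triE /= ?contactE ?linear0l ?linear0r.
  by rewrite !met_phi; ring.
apply: triP => x y z; rewrite ?triE /= ?contactE (met_sym A z) (met_sym A y x); ring.
Qed.

(** The two-form [g x (phi z)] is skew and invariant under [phi]. *)
Lemma F8_eigenpart F : eigenpart false true (F8 A e F).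
Proof.
split; first exact: calF_F8.
  apply: triP => x y z; rewrite ?triE /= ?contactE ?linear0l ?linear0r.
  by rewrite !met_phi ?contactE; ring.
apply: triP => x y z; rewrite ?triE /= ?contactE ?linear0r.
rewrite !(met_sym A _ (φ x)) !phi_skew; ring.
Qed.

Lemma two_n_neq0 : (2 * n)%:R != 0 :> R.
Proof. by rewrite pnatr_eq0 muln_eq0 /= -lt0n n_ge1. Qed.

(** The horizontal metric has trace [(2n+1) - 1], which the normalising factor
    cancels; the same count gives the next lemma. *)
Lemma ftrace_F7 F : ftrace e (F7 A e F) ξ = ftrace e F ξ.
Proof.
rewrite {1}/ftrace /=; set t := ftrace e F ξ; set k := _ * t.
transitivity (\sum_(x <- e) (k * g x x - k * (η x * η x))).
  by apply: eq_bigr => x _; rewrite ?contactE; ring.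
rewrite sumrB -!mulr_sumr (sum_met_diag e_orth) (sum_eta e_orth (p := η)).
  by rewrite eta_xi -natr1 /k; have := mulVKf two_n_neq0 t; lra.
by move=> c u v; rewrite linearP.
Qed.

Lemma fstar_F8 F : fstar A e (F8 A e F) ξ = fstar A e F ξ.
Proof.
rewrite {1}/fstar /=; set t := fstar A e F ξ; set k := _ * t.
transitivity (\sum_(x <- e) (k * (η x * η x) - k * g x x)).
  by apply: eq_bigr => x _; rewrite ?contactE met_phi2r ?contactE linear0r; ring.
rewrite sumrB -!mulr_sumr (sum_met_diag e_orth) (sum_eta e_orth (p := η)).
  by rewrite eta_xi -natr1 /k; have := mulVKf two_n_neq0 t; lra.
by move=> c u v; rewrite linearP.
Qed.

(** Pairing with the horizontal metric is taking the trace. The expression is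
    symmetric in [F] and [G], so [F7] is self-adjoint. *)
Lemma inner_F7 F G : F \in calF A ->
  inner e F (F7 A e G) = (2 * n)%:R^-1 * 2 * ftrace e F ξ * ftrace e G ξ.
Proof.
move=> hF; have V7 := eigenpart_F2 (F7_eigenpart G).
rewrite (inner_vertical e_orth (fun x y z => calF_skew x y z hF) V7).
rewrite (ftrace_xi hF) /=; set k := _ * ftrace e G ξ.
transitivity (2 * \sum_(x <- e) (k * (η x * F x ξ ξ) - k * F x ξ x)).
  congr (_ * _); apply: eq_bigr => x _.
  rewrite -(sum_eta e_orth (tri_scalarr F x ξ)).
  rewrite -(sum_met e_orth x (tri_scalarr F x ξ)) !mulr_sumr -sumrB.
  by apply: eq_bigr => z _; rewrite !contactE (met_sym A x); ring.
rewrite (eq_bigr (fun x => - (k * F x ξ x))); last first.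
  by move=> x _; rewrite calF_xixi //; ring.
by rewrite sumrN -mulr_sumr /k; ring.
Qed.

Lemma inner_F8 F G : F \in calF A ->
  inner e F (F8 A e G) = (2 * n)%:R^-1 * 2 * fstar A e F ξ * fstar A e G ξ.
Proof.
move=> hF; have V8 := eigenpart_F2 (F8_eigenpart G).
rewrite (inner_vertical e_orth (fun x y z => calF_skew x y z hF) V8).
rewrite (fstar_xi hF) /=; set k := _ * fstar A e G ξ.
transitivity (2 * \sum_(x <- e) k * F x ξ (φ x)).
  congr (_ * _); apply: eq_bigr => x _.
  rewrite -(sum_met e_orth (φ x) (tri_scalarr F x ξ)) mulr_sumr.
  apply: eq_bigr => z _; rewrite !contactE linear0r (met_sym A z) phi_skew; ring.
by rewrite -mulr_sumr /k; ring.
Qed.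

End Projections.

(** * The orthogonal projections *)

Section Components.
Variables (R : realType) (V : vectType R) (A : almost_contact_metric V).
Variables (n : nat) (e : (2 * n).+1.-tuple V).
Hypotheses (n_ge1 : (1 <= n)%N) (e_orth : orthonormal_basis A e).
Local Notation φ := (phi A).
Local Notation ξ := (xi A).
Local Notation η := (Defs.eta A).
Local Notation g := (met A).
Implicit Types (F G : trilinear_form V) (a b : bool).

Lemma ftraceB F G z : ftrace e (F - G) z = ftrace e F z - ftrace e G z.
Proof. by rewrite addrC -scaleN1r ftraceD mulN1r addrC. Qed.
Lemma fstarB F G z : fstar A e (F - G) z = fstar A e F z - fstar A e G z.
Proof. by rewrite addrC -scaleN1r fstarD mulN1r addrC. Qed.

Lemma calF2P F : F \in calF2 A e <-> is_calF2 A e F.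
Proof. exact: mem_subspace. Qed.
Lemma calF3P F : F \in calF3 A e <-> is_calF3 A e F.
Proof. exact: mem_subspace. Qed.

Lemma calF4P F : F \in calF4 A e <-> eigenpart A false false F /\ ftrace e F ξ = 0.
Proof.
split=> [/mem_subspace [? h4 h5 ?]|[[? h4 h5] ?]].
  by split=> //; split; rewrite ?scale1r.
by apply/mem_subspace; split; rewrite ?h4 ?h5 ?scale1r.
Qed.
Lemma calF5P F : F \in calF5 A e <-> eigenpart A false true F /\ fstar A e F ξ = 0.
Proof.
split=> [/mem_subspace [? h4 h5 ?]|[[? h4 h5] ?]].
  by split=> //; split; rewrite ?scale1r ?scaleN1r // {2}h5 opprK.
by apply/mem_subspace; split; rewrite ?h4 ?h5 ?scale1r ?scaleN1r ?opprK.
Qed.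
Lemma calF6P F : F \in calF6 A <-> eigenpart A true false F.
Proof.
split=> [/mem_subspace [? h4 h5]|[? h4 h5]].
  by split; rewrite ?scale1r ?scaleN1r // {2}h4 opprK.
by apply/mem_subspace; split; rewrite ?h4 ?h5 ?scale1r ?scaleN1r ?opprK.
Qed.
Lemma calF7P F : F \in calF7 A <-> eigenpart A true true F.
Proof.
split=> [/mem_subspace [? h4 h5]|[? h4 h5]].
  by split=> //; [rewrite scaleN1r {2}h4 opprK | rewrite scaleN1r {2}h5 opprK].
by apply/mem_subspace; split; rewrite ?h4 ?h5 ?scaleN1r ?opprK.
Qed.
Lemma calF8P F : F \in calF8 A <-> is_calF8 A F.
Proof. exact: mem_subspace. Qed.
Lemma vcalFP F : F \in vcalF A <-> is_vcalF A F.
Proof. exact: mem_subspace. Qed.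

Lemma calF2_eigenpart F : F \in calF2 A e -> eigenpart A false false F.
Proof. by case/calF2P => _ ->; exact: F7_eigenpart. Qed.
Lemma calF3_eigenpart F : F \in calF3 A e -> eigenpart A false true F.
Proof. by case/calF3P => _ ->; exact: F8_eigenpart. Qed.

Lemma eigenpartB a b F G : eigenpart A a b F -> eigenpart A a b G -> eigenpart A a b (F - G).
Proof.
move=> [hF F4F F5F] [hG F4G F5G]; split; first exact: rpredB.
  by rewrite addrC -scaleN1r F4D F4F F4G scalerDr !scaleN1r scalerN.
by rewrite addrC -scaleN1r F5D F5F F5G scalerDr !scaleN1r scalerN.
Qed.

Lemma F7_mem F : F7 A e F \in calF2 A e.
Proof.
apply/calF2P; split; first exact: calF_F7.
by apply: triP => x y z /=; rewrite ftrace_F7.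
Qed.
Lemma F8_mem F : F8 A e F \in calF3 A e.
Proof.
apply/calF3P; split; first exact: calF_F8.
by apply: triP => x y z /=; rewrite fstar_F8.
Qed.
(** The eigenpart and its [F7] part have the same trace, since [ftrace _ xi] is
    the character of this eigenpart. *)
Lemma p4_mem F : F \in calF A -> eigenproj A false false F - F7 A e F \in calF4 A e.
Proof.
move=> hF; apply/calF4P; split.
  by apply: eigenpartB; [exact: eigenproj_eigenpart | exact: F7_eigenpart].
rewrite ftraceB ftrace_F7 //.
by rewrite (character_eigenproj false false (ftrace_character e_orth) hF) mul1r subrr.
Qed.
Lemma p5_mem F : F \in calF A -> eigenproj A false true F - F8 A e F \in calF5 A e.
Proof.
move=> hF; apply/calF5P; split.
  by apply: eigenpartB; [exact: eigenproj_eigenpart | exact: F8_eigenpart].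
rewrite fstarB fstar_F8 //.
by rewrite (character_eigenproj false true (fstar_character e_orth) hF) mul1r subrr.
Qed.
Lemma eta_hproj x : η (hproj A x) = 0.
Proof. by rewrite /hproj linearN /= eta_phi oppr0. Qed.

Lemma p8_mem F : F \in calF A -> F1 A F - F3 A F \in calF8 A.
Proof.
move=> hF; have h0 := calF_xixi _ hF; apply/calF8P; split.
- apply/calFP; split=> x y z; rewrite !triE /=.
    by rewrite (calF_skew ξ y z hF); ring.
  by rewrite !contactE (calF_phi ξ y z hF) (calF_xir ξ y hF) ?h0; ring.
- by apply: triP => x y z; rewrite ?triE /= !eta_hproj; ring.
- by move=> x y; rewrite ?triE /= ?contactE ?h0 (calF_xir ξ y hF); ring.
Qed.

Lemma inner_eigenproj a b F G : F \in calF A -> eigenpart A a b G ->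
  inner e (eigenproj A a b F) G = inner e F G.
Proof.
move=> hF EG.
by rewrite (character_eigenproj a b (inner_character e_orth EG) hF) !eqxx mul1r.
Qed.

Lemma calF4_F7_ortho F G : F \in calF4 A e -> inner e F (F7 A e G) = 0.
Proof.
case/calF4P => EF F0; have [hF _ _] := EF.
by rewrite inner_F7 // F0 mulr0 mul0r.
Qed.
Lemma calF5_F8_ortho F G : F \in calF5 A e -> inner e F (F8 A e G) = 0.
Proof.
case/calF5P => EF F0; have [hF _ _] := EF.
by rewrite inner_F8 // F0 mulr0 mul0r.
Qed.

(** For candidates [P] in [U], being the projection of [F] means inducing the same
    functional on [U] as [F]. *)
Lemma component_intro (U : {vspace trilinear_form V}) F P : P \in U ->
  (forall G, G \in U -> inner e P G = inner e F G) -> is_orthogonal_projection e U F P.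
Proof. by move=> PU H; split=> // G GU; rewrite !innerlE H // subrr. Qed.

Lemma p2_component F : F \in calF A ->
  is_orthogonal_projection e (calF2 A e) F (F7 A e F).
Proof.
move=> hF; apply: component_intro => [|G /calF2P[hG ->]]; first exact: F7_mem.
by rewrite !inner_F7 ?calF_F7 // ftrace_F7.
Qed.
Lemma p3_component F : F \in calF A ->
  is_orthogonal_projection e (calF3 A e) F (F8 A e F).
Proof.
move=> hF; apply: component_intro => [|G /calF3P[hG ->]]; first exact: F8_mem.
by rewrite !inner_F8 ?calF_F8 // fstar_F8.
Qed.
Lemma p4_component F : F \in calF A ->
  is_orthogonal_projection e (calF4 A e) F (eigenproj A false false F - F7 A e F).
Proof.
move=> hF; apply: component_intro => [|G hG]; first exact: p4_mem.
have [EG _] := (calF4P G).1 hG.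
by rewrite innerDl innerNl inner_eigenproj // [inner e (F7 A e F) G]innerC calF4_F7_ortho // subr0.
Qed.
Lemma p5_component F : F \in calF A ->
  is_orthogonal_projection e (calF5 A e) F (eigenproj A false true F - F8 A e F).
Proof.
move=> hF; apply: component_intro => [|G hG]; first exact: p5_mem.
have [EG _] := (calF5P G).1 hG.
by rewrite innerDl innerNl inner_eigenproj // [inner e (F8 A e F) G]innerC calF5_F8_ortho // subr0.
Qed.
Lemma p6_component F : F \in calF A ->
  is_orthogonal_projection e (calF6 A) F (eigenproj A true false F).
Proof.
move=> hF; apply: component_intro => [|G /calF6P EG]; last exact: inner_eigenproj.
exact/calF6P/eigenproj_eigenpart.
Qed.
Lemma p7_component F : F \in calF A ->
  is_orthogonal_projection e (calF7 A) F (eigenproj A true true F).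
Proof.
move=> hF; apply: component_intro => [|G /calF7P EG]; last exact: inner_eigenproj.
exact/calF7P/eigenproj_eigenpart.
Qed.

(** Write each argument as its horizontal part plus a multiple of [xi]. *)
Lemma calF_decomp F : F \in calF A -> F = hF A F + F2 A F + (F1 A F - F3 A F).
Proof.
move=> hF; apply: triP => x y z.
rewrite !triE /= /hproj -!scaleN1r.
have N (G : trilinear_form V) u v w :
  G (-1 *: φ (φ u)) (-1 *: φ (φ v)) (-1 *: φ (φ w)) = - G (φ (φ u)) (φ (φ v)) (φ (φ w)).
  rewrite -[-1 *: φ (φ u)]addr0 -[-1 *: φ (φ v)]addr0 -[-1 *: φ (φ w)]addr0.
  by rewrite !triDl !triDm !triDr !(tri0l, tri0m, tri0r); ring.
rewrite N !contactE !(calF_xixi _ hF) !(calF_xir _ _ hF); ring.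
Qed.

Lemma F1_calF8 F : F \in calF8 A -> F = F1 A F.
Proof.
case/calF8P => hF h0 hxi; rewrite {1}(calF_decomp hF) h0 add0r.
apply: triP => x y z; have H u v : F u ξ v = 0.
  by rewrite (calF_skew _ _ _ hF) hxi oppr0.
by rewrite !triE /= !H; ring.
Qed.

(** Elements of [calF8] have the form [eta x * G xi y z], so pairing with one only
    sees values at [x = xi]; there the extra term [F3 F] only meets values of [G]
    with a further argument [xi], which are zero. *)
Lemma p8_component F : F \in calF A ->
  is_orthogonal_projection e (calF8 A) F (F1 A F - F3 A F).
Proof.
move=> hF; apply: component_intro => [|G hG]; first exact: p8_mem.
have [cG _ Gxi] := (calF8P G).1 hG; have G1 := F1_calF8 hG.
have Gxi2 y : G ξ ξ y = 0 by rewrite (calF_skew _ _ _ cG) Gxi oppr0.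
have K H : inner e H G = \sum_(y <- e) \sum_(z <- e) H ξ y z * G ξ y z.
  rewrite /inner exchange_big; apply: eq_bigr => y _.
  rewrite exchange_big; apply: eq_bigr => z _ /=.
  rewrite -(sum_eta e_orth (tri_scalarl H y z)) mulr_suml.
  by apply: eq_bigr => x _; rewrite {1}G1 /=; ring.
rewrite innerDl innerNl [X in _ - X]K [X in X - _]K [RHS]K.
set S := (X in _ - X).
have -> : S = 0; last first.
  rewrite subr0; apply: eq_bigr => y _; apply: eq_bigr => z _.
  by rewrite /= eta_xi mul1r.
transitivity (\sum_(y <- e) (\sum_(z <- e) (η y * (F ξ ξ z * G ξ y z)))
   - \sum_(y <- e) (\sum_(z <- e) (η z * (F ξ ξ y * G ξ y z)))).
  rewrite -sumrB; apply: eq_bigr => y _; rewrite -sumrB.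
  by apply: eq_bigr => z _ /=; rewrite eta_xi; ring.
rewrite exchange_big /= !big1 ?subrr // => y _.
  rewrite (sum_eta e_orth (p := fun z => F ξ ξ y * G ξ y z)) ?Gxi ?mulr0 //.
  by move=> c u v; rewrite triDr; ring.
rewrite (sum_eta e_orth (p := fun z => F ξ ξ y * G ξ z y)) ?Gxi2 ?mulr0 //.
by move=> c u v; rewrite triDm; ring.
Qed.

End Components.

(** * Orthogonal direct sum and invariance *)

Section Decomposition.
Variables (R : realType) (V : vectType R) (A : almost_contact_metric V).
Variables (n : nat) (e : (2 * n).+1.-tuple V).
Hypotheses (n_ge1 : (1 <= n)%N) (e_orth : orthonormal_basis A e).
Local Notation φ := (phi A).
Local Notation ξ := (xi A).
Local Notation η := (Defs.eta A).
Local Notation g := (met A).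
Implicit Types (F G : trilinear_form V).

(** The summands [2] and [3] share the signs of [4] and [5]; those pairs are
    separated by a trace, all other pairs below [8] by their signs. *)
Definition eigen_signs (i : nat) : bool * bool :=
  match i with 2 | 4 => (false, false) | 3 | 5 => (false, true)
  | 6 => (true, false) | _ => (true, true) end.

Lemma summand_eigenpart i F : (2 <= i <= 7)%N -> F \in summand A e i ->
  eigenpart A (eigen_signs i).1 (eigen_signs i).2 F.
Proof.
case: i => [|[|[|[|[|[|[|[|i]]]]]]]] //= _.
- exact: calF2_eigenpart.
- exact: calF3_eigenpart.
- by case/calF4P.
- by case/calF5P.
- by move/calF6P.
- by move/calF7P.
Qed.

Lemma eigenpart_calF8_ortho a b F G : eigenpart A a b F -> G \in calF8 A -> inner e F G = 0.
Proof.
move=> EF /calF8P [hG _ Gxi].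
have skewG x y z : G x y z = - G x z y by apply: calF_skew hG.
rewrite innerC (inner_vertical e_orth skewG (eigenpart_F2 EF)).
rewrite big1 ?mulr0 // => x _; rewrite big1 // => z _.
by rewrite (calF_skew x ξ z hG) Gxi oppr0 mul0r.
Qed.

Lemma summand_ortho_lt i j F G : (2 <= i)%N -> (i < j)%N -> (j <= 8)%N ->
  F \in summand A e i -> G \in summand A e j -> inner e F G = 0.
Proof.
move=> i2 ij j8 Fi Gj.
have i7 : (2 <= i <= 7)%N by rewrite i2 -ltnS (leq_trans ij).
have EF := summand_eigenpart i7 Fi.
have j2 := leq_trans i2 (ltnW ij).
move: j8 Gj; rewrite leq_eqVlt ltnS => /orP[/eqP->|j7] Gj.
  exact: eigenpart_calF8_ortho EF Gj.
have {}j7 : (2 <= j <= 7)%N by rewrite j2.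
have EG := summand_eigenpart j7 Gj.
have [eq|] := eqVneq (eigen_signs i) (eigen_signs j); last first.
  move=> ne; apply: (eigenpart_ortho e_orth EF EG).
  by move: ne; case: (eigen_signs i) (eigen_signs j) => ? ? [].
have {eq} [[iE jE]|[iE jE]] : (i = 2 /\ j = 4) \/ (i = 3 /\ j = 5).
  move: i7 j7 ij eq; clear; do 8?[case: i => [|i] //]; do 8?[case: j => [|j] //]; by [left|right].
- rewrite iE jE /= in Fi Gj; case/calF2P: Fi => _ ->.
  by rewrite innerC (calF4_F7_ortho e_orth).
- rewrite iE jE /= in Fi Gj; case/calF3P: Fi => _ ->.
  by rewrite innerC (calF5_F8_ortho e_orth).
Qed.

Lemma summand_ortho i j : (2 <= i <= 8)%N -> (2 <= j <= 8)%N -> i <> j ->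
  orthogonal_spaces e (summand A e i) (summand A e j).
Proof.
move=> /andP[i2 i8] /andP[j2 j8] ij F G Fi Gj.
have [lt|lt|//] := ltngtP i j; first exact: summand_ortho_lt Fi Gj.
by rewrite innerC; exact: summand_ortho_lt Gj Fi.
Qed.

(** If a sum of vectors is zero, pairing it with its [i]-th term leaves the square
    norm of that term. *)
Lemma directv_orthogonal (I : finType) (U : I -> {vspace trilinear_form V}) :
  (forall i j, i != j -> orthogonal_spaces e (U i) (U j)) -> directv (\sum_i U i).
Proof.
move=> ortho; apply/directv_sum_independent => us Uus us0 i _.
apply: (inner_eq0 e_orth).
have <- : inner e (\sum_j us j) (us i) = inner e (us i) (us i).
  rewrite (bigD1 i) //= innerDl [X in _ + X](_ : _ = 0) ?addr0 //.
  elim/big_rec: _ => [|j F ji F0]; first exact: inner0l.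
  by rewrite innerDl F0 addr0; apply: (ortho j i) => //; apply: Uus.
by rewrite us0 inner0l.
Qed.

Lemma directv_summands : directv (\sum_(2 <= i < 9) summand A e i).
Proof.
have D : directv (\sum_(i < 7) summand A e (i + 2)).
  apply: directv_orthogonal => i j ij.
  apply: summand_ortho; rewrite ?addn2 ?ltnS ?leq_ord //.
  by move=> [] /ord_inj/eqP; apply/negP.
rewrite directvE /= -[2%N]add0n !big_addn !big_mkord.
by apply/eqP; exact: (directvP D).
Qed.

Lemma eigenpart_vcalF a b F : eigenpart A a b F -> F \in vcalF A.
Proof.
move=> EF; have [cF _ _] := EF; apply/vcalFP; split=> //.
  by rewrite (eigenpart_F2 EF); apply: triP => x y z; rewrite /= !eta_hproj; ring.
by move=> z; exact: eigenpart_xi EF.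
Qed.

Lemma summand_vcalF i : (2 <= i <= 8)%N -> (summand A e i <= vcalF A)%VS.
Proof.
move=> /andP[i2 i8]; apply/subvP => F Fi.
move: i8; rewrite leq_eqVlt ltnS => /orP[/eqP iE|i7].
  move: Fi; rewrite iE => /calF8P [cF h0 Fxi]; apply/vcalFP; split=> // z.
  by rewrite /omega (calF_skew _ _ _ cF) Fxi oppr0.
by apply: eigenpart_vcalF (summand_eigenpart _ Fi); rewrite i2.
Qed.

(** The four characters of the group sum to four times the indicator of its
    identity [F2 - F3]. *)
Lemma sum_components F : 
  F7 A e F + F8 A e F + (eigenproj A false false F - F7 A e F)
    + (eigenproj A false true F - F8 A e F) + eigenproj A true false F
    + eigenproj A true true F + (F1 A F - F3 A F)
  = F2 A F + (F1 A F - F3 A F) - F3 A F.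
Proof.
by rewrite /eigenproj; move: (F7 A e F) (F8 A e F) => P2 P3;
   apply: triP => x y z; rewrite !triE /= ?expr1 ?expr0; field.
Qed.

Lemma vcalF_sum : vcalF A = (\sum_(2 <= i < 9) summand A e i)%VS.
Proof.
apply/eqP; rewrite eqEsubv; apply/andP; split; last first.
  rewrite big_nat; elim/big_rec: _ => [|i U ilt UV]; first exact: sub0v.
  by rewrite subv_add UV summand_vcalF.
apply/subvP => F /vcalFP[cF h0 w0].
have F30 : F3 A F = 0.
  by apply: triP => x y z; rewrite /=; move: (w0 z) (w0 y); rewrite /omega => -> ->; ring.
have -> : F = F2 A F + (F1 A F - F3 A F) - F3 A F.
  by rewrite [LHS](calF_decomp cF) h0 add0r F30 !subr0.
rewrite -sum_components /index_iota /= !big_cons big_nil addv0 !addvA.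
by rewrite !memv_add ?F7_mem ?F8_mem ?p4_mem ?p5_mem ?p8_mem //;
   [apply/calF6P | apply/calF7P]; exact: eigenproj_eigenpart.
Qed.

Section Invariance.
Variable a : 'End(V).
Hypothesis aU : in_Un1 A a.
Local Notation a' := (a^-1)%VF.

Lemma Un1_invK : cancel a' a /\ cancel a a'.
Proof.
have [/bij_inj/lker0P ka _ _ _ _] := aU.
by split; [exact: lker0_lfunVK | exact: lker0_lfunK].
Qed.

Lemma Un1_inv_phi x : φ (a' x) = a' (φ x).
Proof.
by have [K1 K2] := Un1_invK; have [_ H _ _ _] := aU; rewrite -[LHS]K2 H K1.
Qed.
Lemma Un1_inv_xi : a' ξ = ξ.
Proof. by have [K1 K2] := Un1_invK; have [_ _ H _ _] := aU; rewrite -{1}H K2. Qed.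
Lemma Un1_inv_eta x : η (a' x) = η x.
Proof. by have [K1 K2] := Un1_invK; have [_ _ _ H _] := aU; rewrite -H K1. Qed.
Lemma Un1_inv_met x y : g (a' x) y = g x (a y).
Proof. by have [K1 K2] := Un1_invK; have [_ _ _ _ H] := aU; rewrite -H K1. Qed.
Lemma Un1_inv_met2 x y : g (a' x) (a' y) = g x y.
Proof. by rewrite Un1_inv_met Un1_invK.1. Qed.

(** The adjoint of [a^-1] is [a], so moving one factor across the trace cancels
    the other; for [fstar] one uses in addition that [a^-1] commutes with [phi]. *)
Lemma act_ftrace F : ftrace e (act a F) ξ = ftrace e F ξ.
Proof.
rewrite /ftrace /= Un1_inv_xi.
have B : bilinear_fun (fun x y => F x (a' y) ξ).
  by split=> w c u v; rewrite ?linearP ?triDl ?triDm.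
rewrite (sum_adjoint e_orth B Un1_inv_met); apply: eq_bigr => x _.
by rewrite Un1_invK.2.
Qed.

Lemma act_fstar F : fstar A e (act a F) ξ = fstar A e F ξ.
Proof.
rewrite /fstar /= Un1_inv_xi.
have B : bilinear_fun (fun x y => F x (φ (a' y)) ξ).
  by split=> w c u v; rewrite ?linearP ?triDl ?triDm.
under eq_bigr => x _ do rewrite -Un1_inv_phi.
rewrite (sum_adjoint e_orth B Un1_inv_met); apply: eq_bigr => x _.
by rewrite Un1_invK.2.
Qed.

Lemma act_F4 F : act a (F4 A F) = F4 A (act a F).
Proof. by apply: triP => x y z /=; rewrite !Un1_inv_eta !Un1_inv_phi Un1_inv_xi. Qed.
Lemma act_F5 F : act a (F5 A F) = F5 A (act a F).
Proof. by apply: triP => x y z /=; rewrite !Un1_inv_eta Un1_inv_xi. Qed.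
Lemma act_F7 F : act a (F7 A e F) = F7 A e (act a F).
Proof. by apply: triP => x y z /=; rewrite act_ftrace !Un1_inv_eta !Un1_inv_met2. Qed.
Lemma act_F8 F : act a (F8 A e F) = F8 A e (act a F).
Proof.
by apply: triP => x y z /=; rewrite act_fstar !Un1_inv_eta !Un1_inv_phi !Un1_inv_met2.
Qed.
Lemma act_hF F : act a (hF A F) = hF A (act a F).
Proof.
by apply: triP => x y z /=; rewrite /hproj !linearN /= !Un1_inv_phi.
Qed.
Lemma actZ c F : act a (c *: F) = c *: act a F.
Proof. exact: triP. Qed.

Lemma act_calF F : F \in calF A -> act a F \in calF A.
Proof.
move=> cF; apply/calFP; split=> x y z /=; first exact: (calF_skew _ _ _ cF).
rewrite -!Un1_inv_phi (calF_phi _ _ _ cF) Un1_inv_xi !Un1_inv_eta (calF_xir _ _ cF).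
ring.
Qed.

Lemma act_eigenpart b c F : eigenpart A b c F -> eigenpart A b c (act a F).
Proof.
move=> [cF F4F F5F]; split; first exact: act_calF.
  by rewrite -act_F4 F4F actZ.
by rewrite -act_F5 F5F actZ.
Qed.

Lemma act_summand i F : F \in summand A e i -> act a F \in summand A e i.
Proof.
case: i => [|[|[|[|[|[|[|[|[|i]]]]]]]]] /=;
  try by rewrite !memv0 => /eqP->; apply/eqP/triP.
- by case/calF2P => cF FE; apply/calF2P; split; [exact: act_calF | rewrite -act_F7 -FE].
- by case/calF3P => cF FE; apply/calF3P; split; [exact: act_calF | rewrite -act_F8 -FE].
- by case/calF4P => EF F0; apply/calF4P; rewrite act_ftrace; split=> //; exact: act_eigenpart.
- by case/calF5P => EF F0; apply/calF5P; rewrite act_fstar; split=> //; exact: act_eigenpart.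
- by move/calF6P/act_eigenpart/calF6P.
- by move/calF7P/act_eigenpart/calF7P.
case/calF8P => cF h0 Fxi; apply/calF8P; split; first exact: act_calF.
  by rewrite -act_hF h0; apply: triP.
by move=> x y /=; rewrite Un1_inv_xi.
Qed.

End Invariance.
End Decomposition.

Theorem proposition2 (R : realType) (n : nat) (n_ge1 : (1 <= n)%N)
    (V : vectType R) (dimV : \dim {: V} = (2 * n).+1)
    (A : almost_contact_metric V)
    (e : (2 * n).+1.-tuple V) (orthonormal_e : orthonormal_basis A e) :
  [/\ vcalF A = (\sum_(2 <= i < 9) summand A e i)%VS
        /\ directv (\sum_(2 <= i < 9) summand A e i),
      forall i j : nat, (2 <= i <= 8)%N -> (2 <= j <= 8)%N -> i <> j ->
        orthogonal_spaces e (summand A e i) (summand A e j),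
      forall i : nat, (2 <= i <= 8)%N ->
        forall a : 'End(V), in_Un1 A a ->
        forall F : trilinear_form V,
          F \in summand A e i -> act a F \in summand A e i &
      forall F : trilinear_form V, F \in calF A ->
        let is_component U P := is_orthogonal_projection e U F P in
        is_component (calF2 A e) (F7 A e F) /\
        is_component (calF3 A e) (F8 A e F) /\
        is_component (calF4 A e)
          (4^-1 *: (F2 A F + F4 A F + F5 A F + F6 A F - 4 *: F7 A e F - F3 A F)) /\
        is_component (calF5 A e)
          (4^-1 *: (F2 A F + F4 A F - F5 A F - F6 A F - 4 *: F8 A e F - F3 A F)) /\
        is_component (calF6 A)
          (4^-1 *: (F2 A F - F4 A F + F5 A F - F6 A F - F3 A F)) /\
        is_component (calF7 A)
          (4^-1 *: (F2 A F - F4 A F - F5 A F + F6 A F - F3 A F)) /\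
        is_component (calF8 A) (F1 A F - F3 A F)].
Proof.
split; first by split; [exact: vcalF_sum | exact: directv_summands].
- exact: summand_ortho.
- by move=> i _ a aU F; exact: act_summand.
move=> F cF is_component; rewrite /is_component.
split; first exact: p2_component.
split; first exact: p3_component.
split.
  rewrite (_ : 4^-1 *: _ = eigenproj A false false F - F7 A e F); first exact: p4_component.
  by rewrite /eigenproj; move: (F7 A e F) => P; apply: triP => x y z; rewrite ?triE /= ?expr1 ?expr0; field.
split.
  rewrite (_ : 4^-1 *: _ = eigenproj A false true F - F8 A e F); first exact: p5_component.
  by rewrite /eigenproj; move: (F8 A e F) => P; apply: triP => x y z; rewrite ?triE /= ?expr1 ?expr0; field.
split.
  rewrite (_ : 4^-1 *: _ = eigenproj A true false F); first exact: p6_component.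
  by rewrite /eigenproj; apply: triP => x y z; rewrite ?triE /= ?expr1 ?expr0; field.
split; last exact: p8_component.
rewrite (_ : 4^-1 *: _ = eigenproj A true true F); first exact: p7_component.
by rewrite /eigenproj; apply: triP => x y z; rewrite ?triE /= ?expr1 ?expr0; field.
Qed.
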